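(* Let $d\ge1$. Let $f$ be the height function of the RSOS surface on $\mathbb{Z}^d$ with zero initial condition $f(0,x)=0$, and let $f^D$ be the height function of the dual RSOS surface on $\mathbb{Z}^d$, i.e. the RSOS process with initial condition $f^D(0,x)=\|x\|_1$. Then for every fixed $t\ge0$, $$f(t,0)\stackrel{(d)}{=}\min_{y\in\mathbb{Z}^d}f^D(t,y),$$ where $\stackrel{(d)}{=}$ denotes equality in distribution.
   Context: RSOS (Restricted Solid-on-Solid) dynamics: let $\mathcal{N}=\{\pm e_i\}_{i=1}^d$. Independent rate-$1$ Poisson clocks are attached to the sites of $\mathbb{Z}^d$. The height $h:\mathbb{R}_+\times\mathbb{Z}^d\to\mathbb{Z}$ is right-continuous in time; the height at $x$ can only change when the clock at $x$ rings, and when the clock at $x$ rings at time $t$, $$h(t,x)=h(t^-,x)+\prod_{n\in\mathcal{N}}\mathbf{1}\{h(t^-,x)\le h(t^-,x+n)\},$$ where $t^-$ denotes the left limit in time. The process is almost surely well defined. The RSOS process $f$ and the dual RSOS process $f^D$ both follow these dynamics, with initial conditions $f(0,x)=0$ and $f^D(0,x)=\|x\|_1=\sum_{i=1}^d|x_i|$ respectively. *)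

(* Defs.v *)
From HB Require Import structures.
From mathcomp Require Import all_boot all_order all_algebra finmap.
From mathcomp Require Import all_classical all_reals all_analysis.

Set Implicit Arguments.
Unset Strict Implicit.
Unset Printing Implicit Defensive.

Import Order.TTheory GRing.Theory Num.Theory numFieldNormedType.Exports.

Local Open Scope classical_set_scope.
Local Open Scope ring_scope.

HB.instance Definition _ := isPointed.Build int 0.
HB.instance Definition _ := @isMeasurable.Build default_measure_display
  int discrete_measurable discrete_measurable0
  discrete_measurableC discrete_measurableU.

(* The families need not be sigma-algebras, but below they always are. *)
Definition mutually_independent {R : realType} {dsp : measure_display}
    {T : measurableType dsp} (P : probability T R) {I : choiceType}
    (F : I -> set (set T)) : Prop :=
  forall (J : {fset I}) (A : I -> set T), (forall i, i \in J -> F i (A i)) ->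
    P (\bigcap_(i in [set` J]) A i) = (\prod_(i <- J) P (A i))%E.

Definition sigma_of_process {R : realType} {T : Type} {dsp : measure_display}
    {S : measurableType dsp} (X : R -> T -> S) : set (set T) :=
  <<s \bigcup_(t in [set t : R | 0 <= t])
        preimage_set_system setT (X t) measurable >>.

(* Processes are indexed by the whole of R; only times t >= 0 are constrained. *)
Record poisson_process {R : realType} {dsp : measure_display}
    {T : measurableType dsp} (P : probability T R)
    (N : R -> {RV P >-> nat}) : Prop := PoissonProcess {
  poisson_process_init : {ae P, forall w, N 0 w = 0%N} ;
  poisson_process_path : {ae P, forall w,
    (forall s t : R, 0 <= s -> s <= t -> (N s w <= N t w)%N) /\
    (forall t : R, 0 <= t -> \forall s \near t^'+, N s w = N t w)} ;
  poisson_process_law : forall s t : R, 0 <= s -> s < t -> forall k : nat,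
    P [set w | (N t w - N s w)%N = k] = (poisson_pmf (t - s) k)%:E ;
  poisson_process_indep : forall u : nat -> R,
    0 <= u 0%N -> nondecreasing_seq u ->
    mutually_independent P (fun i : nat =>
      preimage_set_system setT (fun w => (N (u i.+1) w - N (u i) w)%N)
        measurable) }.

Definition site (d : nat) := 'rV[int]_d.

Definition norm1 (d : nat) (x : site d) : int := \sum_(i < d) `|x ord0 i|.

Definition neighbours (d : nat) : seq (site d) :=
  [seq delta_mx ord0 i | i <- enum 'I_d] ++
  [seq - delta_mx ord0 i | i <- enum 'I_d].

Record poisson_clocks {R : realType} {d : nat} {dsp : measure_display}
    {T : measurableType dsp} (P : probability T R)
    (N : site d -> R -> {RV P >-> nat}) : Prop := PoissonClocks {
  poisson_clocksP : forall x, poisson_process (N x) ;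
  poisson_clocks_indep :
    mutually_independent P
      (fun x => sigma_of_process (fun t => N x t : T -> nat)) }.

(* The jump times of a nondecreasing counting path. *)
Definition rings {R : realType} (c : R -> nat) (t : R) : Prop :=
  0 < t /\ forall s, 0 <= s -> s < t -> (c s < c t)%N.

(* Left and right limits of heights are taken in the discrete space int,
   i.e. they are reached by functions that are eventually constant. *)
Record rsos_path {R : realType} {d : nat} (ring : site d -> R -> Prop)
    (h0 : site d -> int) (h : R -> site d -> int) : Prop := RsosPath {
  rsos_init : forall x, h 0 x = h0 x ;
  rsos_right_continuous : forall (t : R) x, 0 <= t ->
    \forall s \near t^'+, h s x = h t x ;
  rsos_frozen : forall (s t : R) x, 0 <= s -> s <= t ->
    (forall u : R, s < u -> u <= t -> ~ ring x u) -> h t x = h s x ;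
  rsos_jump : forall (t : R) x, 0 < t -> ring x t ->
    exists hl : site d -> int,
      (forall y, \forall s \near t^'-, h s y = hl y) /\
      h t x = hl x + \prod_(n <- neighbours d) (hl x <= hl (x + n))%R%:R }.

Definition rsos_process {R : realType} {d : nat} {dsp : measure_display}
    {T : measurableType dsp} (P : probability T R)
    (N : site d -> R -> {RV P >-> nat}) (h0 : site d -> int)
    (h : R -> site d -> {RV P >-> int}) : Prop :=
  poisson_clocks N /\
  {ae P, forall w,
    rsos_path (fun x => rings (fun t => N x t w)) h0 (fun t x => h t x w)}.

Definition minimizer {I : Type} (g : I -> int) (y : I) : Prop :=
  forall z, g y <= g z.

(* Equal to 0 when g has no minimum. *)
Definition min_value {I : Type} (g : I -> int) : int :=
  xget 0 [set g y | y in minimizer g].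

Lemma min_value_eq {I : Type} (g : I -> int) y :
  minimizer g y -> min_value g = g y.
Proof.
move=> gy; rewrite /min_value; case: xgetP => [k -> [z gz <-]|/(_ (g y)) []].
  by apply/eqP; rewrite eq_le gz gy.
by exists y.
Qed.

Definition min_height {dsp : measure_display} {T : measurableType dsp}
    {d : nat} (g : site d -> {mfun T >-> int}) (w : T) : int :=
  min_value (fun y => g y w).

Section min_height_measurable.
Context {dsp : measure_display} {T : measurableType dsp} {d : nat}.
Variable g : site d -> {mfun T >-> int}.

Let E (y : site d) : set T := [set w | minimizer (fun z => g z w) y].

Let mE y : measurable (E y).
Proof.
have -> : E y = ~` \bigcup_(z in [set: site d]) [set w | ~~ (g y w <= g z w)].
  rewrite setC_bigcup; apply/seteqP; split => w Ew z.
    by move=> _ /negP; apply; exact: Ew.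
  by apply/negPn/negP; exact: Ew.
apply: measurableC; apply: countable_bigcupT_measurable => [|z].
  exact: countableP.
have -> : [set w | ~~ (g y w <= g z w)] =
    \bigcup_(k in [set: int]) (g y @^-1` [set k] `&` g z @^-1` [set l | l < k]).
  apply/seteqP; split => [w /=|w [k _ [/= -> ]]]; rewrite -ltNge //.
  by exists (g y w).
apply: countable_bigcupT_measurable => [|k]; first exact: countableP.
by apply: measurableI; rewrite -[X in measurable X]setTI;
  apply: measurable_funPT.
Qed.

Lemma measurable_min_height : measurable_fun setT (min_height g).
Proof.
move=> _ A _; rewrite setTI.
pose U := \bigcup_(y in [set: site d]) E y.
have mU : measurable U.
  by apply: countable_bigcupT_measurable => //; exact: countableP.
have -> : min_height g @^-1` A =
    \bigcup_(y in [set: site d]) (E y `&` g y @^-1` A) `|`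
    (~` U `&` [set _ | A 0]).
  apply/seteqP; split => w /=.
  - rewrite /min_height => Aw.
    have [[y Ey]|nE] := pselect (exists y, E y w).
      by left; exists y => //; split=> //=; rewrite -(min_value_eq Ey).
    right; split; first by move=> [y _ Ey]; apply: nE; exists y.
    move: Aw; rewrite /min_value; case: xgetP => [k -> [y Ey _]|//].
    by case: nE; exists y.
  - move=> [[y _ [Ey /= Agy]]|[nU A0]].
      by rewrite /min_height (min_value_eq Ey).
    rewrite /min_height /min_value; case: xgetP => [k -> [y Ey _]|//].
    by case: nU; exists y.
apply: measurableU.
  apply: countable_bigcupT_measurable => [|y]; first exact: countableP.
  by apply: measurableI => //; rewrite -[X in measurable X]setTI;
    apply: measurable_funPT.
apply: measurableI; first exact: measurableC.
have [A0|nA0] := pselect (A 0).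
  by rewrite (_ : [set _ | _] = setT) //; apply/seteqP; split.
by rewrite (_ : [set _ | _] = set0) //; apply/seteqP; split.
Qed.

HB.instance Definition _ :=
  isMeasurableFun.Build _ _ _ _ (min_height g) measurable_min_height.

End min_height_measurable.

(* Main.v *)
Require Import Defs.
From HB Require Import structures.
From mathcomp Require Import all_boot all_order all_algebra finmap.
From mathcomp Require Import all_classical all_reals all_analysis.
From mathcomp Require Import lra zify ring.

Import Order.TTheory GRing.Theory Num.Theory numFieldNormedType.Exports.
Local Open Scope classical_set_scope.
Local Open Scope ring_scope.

(** Call a height function Lipschitz when neighbouring heights differ by at
    most one.  On such functions a ring at [x] replaces [h x] by one plus the
    minimum of [h] over [x] and its neighbours.  Hence, for Lipschitz [h] and
    [g], the pairing [min_y (h y + g y)] does not distinguish a ring at [x]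
    applied to [h] from the same ring applied to [g]: in both cases it becomes
    the minimum of [h x + g x + 1] and of the [h y + g y] with [y <> x]
    ([pairing_step]).  Start [h] from the flat surface and run it forwards
    through the rings of [[0, t]]; start [g] from [norm1] and run it through
    the same rings backwards.  As [h] stays Lipschitz, its pairing with [norm1]
    is its height at the origin, while the pairing of [g] with the flat surface
    is the minimum of [g].  So the height at the origin of the flat surface is
    the minimum of the dual surface driven by the time-reversed rings, and
    Poisson clocks are invariant in law under time reversal.

    Three points make this rigorous on the infinite lattice.

    - Only the events [height <= K] are compared.  In each pairing one function
      is nonnegative and the other is at least [norm1], so a site that brings
      the pairing down to [K] lies in the ball of radius [K]: what happens far
      away is irrelevant ([flat_origin], [wedge_min]).

    - The interval [[0, t]] is cut into [n] slots of length [delta].  A sequence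
      of [n] symbols, each either a site of a fixed finite box or [None], says
      which single site of the box, if any, rings in each slot.  The event that
      the clocks realise a given sequence determines both height events, and
      its probability is a product of weights of the symbols
      ([probability_slots_event]); it is therefore unchanged when the sequence
      is reversed.

    - These events miss only a probability of order [1 / n]
      ([total_slots_weight]), because two rings of the box seldom share a
      slot.  Letting [n] grow gives equality of the distribution functions
      ([rsos_duality_rays]). *)

Set Implicit Arguments.
Unset Strict Implicit.
Unset Printing Implicit Defensive.

(** * Geometry of the lattice *)

Lemma neighboursP (d : nat) (n : site d) :
  n \in neighbours d ->
  exists i, n = delta_mx ord0 i \/ n = - delta_mx ord0 i.
Proof.
by rewrite mem_cat => /orP[] /mapP[i _ ->]; exists i; [left|right].
Qed.

Lemma delta_neighbours (d : nat) (i : 'I_d) :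
  delta_mx ord0 i \in neighbours d /\ - delta_mx ord0 i \in neighbours d.
Proof.
by split; rewrite mem_cat; apply/orP; [left|right]; apply/mapP; exists i;
  rewrite ?mem_enum.
Qed.

Lemma neighbours_opp (d : nat) (n : site d) :
  n \in neighbours d -> - n \in neighbours d.
Proof.
move=> /neighboursP[i [->|->]]; first by have [] := delta_neighbours i.
by rewrite opprK; have [] := delta_neighbours i.
Qed.

Lemma norm1_ge0 (d : nat) (x : site d) : 0 <= norm1 x.
Proof. exact: sumr_ge0. Qed.

Lemma norm10 (d : nat) : norm1 (0 : site d) = 0.
Proof. by rewrite /norm1 big1// => i _; rewrite mxE normr0. Qed.

(** Every neighbour is [a *: delta_mx ord0 i] with [a] a sign, so this one
    computation of the norm serves all the moves on the lattice. *)
Lemma norm1_move (d : nat) (x : site d) (i : 'I_d) (a : int) :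
  norm1 (x + a *: delta_mx ord0 i) =
  norm1 x - `|x ord0 i| + `|x ord0 i + a|.
Proof.
rewrite /norm1 (bigD1 i)//= [in RHS](bigD1 i)//= !mxE !eqxx mulr1.
have -> : \sum_(j < d | j != i) `|(x + a *: delta_mx ord0 i) ord0 j| =
    \sum_(j < d | j != i) `|x ord0 j|.
  by apply: eq_bigr => j /negPf ji; rewrite !mxE eqxx ji mulr0 addr0.
by rewrite [X in X - _ + _]addrC addrK addrC.
Qed.

Lemma neighbours_scale (d : nat) (n : site d) : n \in neighbours d ->
  exists i, exists2 a : int, `|a| = 1 & n = a *: delta_mx ord0 i.
Proof.
move=> /neighboursP[i [->|->]]; exists i; [exists 1|exists (-1)] => //.
  by rewrite scale1r.
by rewrite scaleN1r.
Qed.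

Lemma neighbours_neq (d : nat) (x n : site d) : n \in neighbours d ->
  x + n != x.
Proof.
move=> /neighbours_scale[i [a a1 ->]]; apply/eqP => /matrixP/(_ ord0 i).
by rewrite !mxE !eqxx mulr1; lia.
Qed.

Lemma norm1_neighbour (d : nat) (x n : site d) : n \in neighbours d ->
  norm1 (x + n) <= norm1 x + 1.
Proof.
by move=> /neighbours_scale[i [a a1 ->]]; rewrite norm1_move; lia.
Qed.

Lemma norm1_descent (d : nat) (x : site d) : 0 < norm1 x ->
  exists2 n, n \in neighbours d & norm1 (x + n) = norm1 x - 1.
Proof.
move=> x_gt0; have [i xi] : exists i, x ord0 i != 0.
  apply/existsP; rewrite -[X in is_true X]negbK negb_exists.
  apply/negP => /forallP x0.
  move: x_gt0; rewrite /norm1 big1 ?ltxx// => i _.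
  by have := x0 i; rewrite negbK => /eqP ->; rewrite normr0.
have [d1 d2] := delta_neighbours i.
case: (ltrP 0 (x ord0 i)) => xi0.
  exists (- delta_mx ord0 i) => //; rewrite -scaleN1r norm1_move; lia.
exists (delta_mx ord0 i) => //; rewrite -[delta_mx _ _]scale1r norm1_move; lia.
Qed.

(** * Self-adjointness of the RSOS update *)

(** The index is optional so that a list of updates can record the time slots
    in which nothing happens. *)
Definition rsos_update {d : nat} (o : option (site d)) (h : site d -> int) :
    site d -> int :=
  fun y => if o == Some y
           then h y + \prod_(n <- neighbours d) (h y <= h (y + n))%R%:R
           else h y.

Lemma prod_nat_of_bool (T : Type) (s : seq T) (b : T -> bool) :
  \prod_(n <- s) (b n)%:R = (all b s)%:R :> int.
Proof.
elim: s => [|x s IH]; first by rewrite big_nil.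
by rewrite big_cons IH /=; case: (b x); rewrite ?mul1r ?mul0r.
Qed.

Lemma rsos_update_ge (d : nat) o (h : site d -> int) y :
  h y <= rsos_update o h y.
Proof. by rewrite /rsos_update prod_nat_of_bool; case: ifP => // _; lia. Qed.

(** Neighbour pairs are symmetric, so the one-sided bound suffices.  It is asked
    in the ball of radius [K + 1] because the pairing argument compares a site of
    the ball of radius [K] with its neighbours. *)
Definition lipschitz_ball {d : nat} (K : int) (h : site d -> int) :=
  forall x n, n \in neighbours d ->
    norm1 x <= K + 1 -> norm1 (x + n) <= K + 1 -> h (x + n) <= h x + 1.

Lemma lipschitz_norm1 (d : nat) (K : int) : lipschitz_ball K (@norm1 d).
Proof. by move=> x n nd _ _; exact: norm1_neighbour. Qed.

Lemma lipschitz_0 (d : nat) (K : int) : @lipschitz_ball d K (fun=> 0).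
Proof. by []. Qed.

(** A raised site was a local minimum, so it lands at most one above each
    neighbour; the property of a pair of sites only involves the updates of these
    two sites, which is why it can be localised to a ball. *)
Lemma lipschitz_update (d : nat) (K : int) o (h h' : site d -> int) :
  lipschitz_ball K h ->
  (forall y, norm1 y <= K + 1 -> h' y = rsos_update o h y) ->
  lipschitz_ball K h'.
Proof.
move=> hL hh' x n nd xK xnK; rewrite !hh'// /rsos_update !prod_nat_of_bool.
have L1 := hL x n nd xK xnK.
case: eqP => [->|_]; last by case: ifP => // _; lia.
rewrite ifF; last first.
  by apply/negbTE; rewrite (inj_eq Some_inj) neighbours_neq.
case: (boolP (all _ _)) => [/allP/(_ _ (neighbours_opp nd))|_].
  by rewrite addrK; lia.
by lia.
Qed.

(** Follow a shortest path from [x] to the origin: it stays in the ball, and each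
    step costs at most one. *)
Lemma lipschitz_origin (d : nat) (K : int) (h : site d -> int) x :
  lipschitz_ball K h -> norm1 x <= K + 1 -> h 0 <= h x + norm1 x.
Proof.
move=> hL; move: {2}`|norm1 x|%N (erefl `|norm1 x|%N) => m.
elim: m x => [|m IH] x xm xK.
  suff -> : x = 0 by rewrite norm10 addr0.
  apply/eqP; apply/negP => /negP xn0; have x_ge0 := norm1_ge0 x.
  have x0 : norm1 x = 0 by lia.
  case/negP: xn0; apply/eqP/rowP => i; rewrite mxE; apply/eqP.
  rewrite -normr_eq0; move/eqP: x0; rewrite psumr_eq0//.
  by move=> /allP/(_ i); rewrite mem_index_enum => /(_ isT).
have x_ge0 := norm1_ge0 x.
have [|n nd xn] := @norm1_descent d x; first by lia.
have := IH (x + n); rewrite xn => /(_ ltac:(lia) ltac:(lia)).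
have := hL _ _ nd xK; rewrite xn; lia.
Qed.

(** Half of the self-adjointness of the update; the other half is the same
    statement with the roles of the two functions exchanged.  The only way for
    [g] to lose when the update is moved from [h] to [g] at [y] is that [h] was
    blocked at [y], by a neighbour lower than [y]; but then the Lipschitz bound on
    [g'] makes that neighbour a competitor that is at least as good.  The lower
    bound by [norm1] confines the argument to the ball of radius [K + 1], in which
    alone the updates are known. *)
Lemma pairing_step (d : nat) (K : int) o (h h' g g' : site d -> int) :
  (forall y, norm1 y <= K + 1 -> h' y = rsos_update o h y) ->
  (forall y, norm1 y <= K + 1 -> g y = rsos_update o g' y) ->
  lipschitz_ball K g' ->
  (forall y, norm1 y <= h' y + g' y) ->
  (exists y, h' y + g' y <= K) -> exists y, h y + g y <= K.
Proof.
move=> hh' gg' gL hg [y yK]; have yn := hg y.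
have yK1 : norm1 y <= K + 1 by lia.
have := hh' _ yK1; have := gg' _ yK1; rewrite /rsos_update !prod_nat_of_bool.
case: (eqVneq o (Some y)) => [oy|_]; last by move=> gy hy; exists y; lia.
case: (boolP (all (fun n => h y <= h (y + n)) _)) => [_|/allPn[n nd]].
  by move=> gy hy; exists y; lia.
rewrite -ltNge => hn gy hy; exists (y + n).
have := norm1_neighbour y nd => ynn.
rewrite gg'; last by lia.
rewrite /rsos_update oy ifF; last first.
  by apply/negbTE; rewrite (inj_eq Some_inj) eq_sym neighbours_neq.
have := gL y n nd ltac:(lia) ltac:(lia); lia.
Qed.

(** * Duality along a list of updates *)

Definition evolve {d : nat} (s : seq (option (site d))) (h : site d -> int) :
  site d -> int := foldl (fun h o => rsos_update o h) h s.

Lemma evolve_rcons (d : nat) s o (h : site d -> int) :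
  evolve (rcons s o) h = rsos_update o (evolve s h).
Proof. by rewrite /evolve foldl_rcons. Qed.

Lemma evolve_ge (d : nat) s (h : site d -> int) y : h y <= evolve s h y.
Proof.
elim/last_ind: s => [|s o IH] //; rewrite evolve_rcons.
by rewrite (le_trans IH)// rsos_update_ge.
Qed.

Lemma lipschitz_evolve (d : nat) (K : int) s (h : site d -> int) :
  lipschitz_ball K h -> lipschitz_ball K (evolve s h).
Proof.
move=> hL; elim/last_ind: s => [|s o IH] //; rewrite evolve_rcons.
exact: (lipschitz_update (o := o) IH).
Qed.

(** Outside the ball of radius [K + 1] the sequence is left arbitrary: the true
    surface is only controlled in a finite box. *)
Definition follows {d : nat} (K : int) (s : seq (option (site d)))
    (h : nat -> site d -> int) :=
  forall i, (i < size s)%N -> forall y, norm1 y <= K + 1 ->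
    h i.+1 y = rsos_update (nth None s i) (h i) y.

Lemma lipschitz_follows (d : nat) (K : int) s (h : nat -> site d -> int) :
  follows K s h -> lipschitz_ball K (h 0%N) ->
  forall i, (i <= size s)%N -> lipschitz_ball K (h i).
Proof.
move=> hs h0; elim=> [//|i IH] si.
exact: (lipschitz_update (IH (ltnW si)) (hs _ si)).
Qed.

(** Moving the updates of [s] one by one, the last one first, from [h] to [g]
    makes [g] meet them in reverse order. *)
Lemma pairing_duality (d : nat) (K : int) s (h : nat -> site d -> int)
    (g : site d -> int) :
  follows K s h -> lipschitz_ball K (h 0%N) -> lipschitz_ball K g ->
  (forall i y, (i <= size s)%N -> norm1 y <= h i y + g y) ->
  (exists y, h (size s) y + g y <= K) <->
  (exists y, h 0%N y + evolve (rev s) g y <= K).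
Proof.
elim: s h => [//|o s IH] h hs h0 gL hg; rewrite rev_cons evolve_rcons /=.
have h1 : lipschitz_ball K (h 1%N).
  exact: (lipschitz_follows hs h0 (i := 1%N)).
rewrite (IH (fun i => h i.+1)) => [|i si y yK| | |i y si]; last 4 first.
- exact: (hs i.+1).
- exact: h1.
- exact: gL.
- exact: hg.
set g' := evolve _ g; have g'L : lipschitz_ball K g' by exact: lipschitz_evolve.
have gg' y : g y <= g' y by exact: evolve_ge.
split.
  apply: (@pairing_step d K o) => //; first exact: (hs 0%N).
  by move=> y; have := hg 1%N y isT; have := gg' y; lia.
move=> [y yK].
have [|||z zK] := @pairing_step d K o g' (rsos_update o g') (h 1%N) (h 0%N) _
  (hs 0%N isT) h0.
- by [].
- move=> z; have := hg 0%N z isT; have := gg' z.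
  by have := rsos_update_ge o g' z; lia.
- by exists y; rewrite addrC.
- by exists z; rewrite addrC.
Qed.

Lemma follows_evolve (d : nat) (K : int) s (h : site d -> int) :
  follows K s (fun i => evolve (take i s) h).
Proof. by move=> i si y yK; rewrite (take_nth None si) evolve_rcons. Qed.

Lemma evolve_duality (d : nat) (K : int) s (h g : site d -> int) :
  lipschitz_ball K h -> lipschitz_ball K g ->
  (forall y, norm1 y <= h y + g y) ->
  (exists y, evolve s h y + g y <= K) <->
  (exists y, h y + evolve (rev s) g y <= K).
Proof.
move=> hL gL hg.
have := pairing_duality (g := g) (@follows_evolve d K s h).
rewrite take_size take0; apply=> // i y _.
by have := hg y; have := evolve_ge (take i s) h y; lia.
Qed.

(** The pairing of a Lipschitz function with [norm1] is its value at the
    origin. *)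
Lemma flat_origin (d : nat) (K : int) s (h : nat -> site d -> int) :
  follows K s h -> (forall y, h 0%N y = 0) ->
  (forall i y, (i <= size s)%N -> 0 <= h i y) ->
  (h (size s) 0 <= K) <-> exists y, evolve (rev s) (@norm1 d) y <= K.
Proof.
move=> hs h0 hge0.
have h0L : lipschitz_ball K (h 0%N) by move=> x n; rewrite !h0.
have nL := @lipschitz_norm1 d K.
have hg i y : (i <= size s)%N -> norm1 y <= h i y + norm1 y.
  by move=> si; have := hge0 _ y si; lia.
have dual := pairing_duality hs h0L nL hg.
split=> [hK|[y yK]].
  have /dual[y] : exists y, h (size s) y + norm1 y <= K.
    by exists 0; rewrite norm10 addr0.
  by rewrite h0 add0r; exists y.
have /dual[z zK] : exists y, h 0%N y + evolve (rev s) (@norm1 d) y <= K.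
  by exists y; rewrite h0 add0r.
have hz := hge0 _ z (leqnn _).
apply: (le_trans _ zK); apply: (@lipschitz_origin d K) => //.
  exact: (lipschitz_follows hs h0L).
by lia.
Qed.

(** The duality is used twice: to replace the infinite system [h] by the
    evolution of the flat surface under the reversed updates, and then to turn
    the latter back into a genuine evolution of [norm1].  The flat surface is the
    constant function against which the pairing is a minimum. *)
Lemma wedge_min (d : nat) (K : int) s (h : nat -> site d -> int) :
  follows K s h -> (forall y, h 0%N y = norm1 y) ->
  (forall i y, (i <= size s)%N -> norm1 y <= h i y) ->
  (exists y, h (size s) y <= K) <-> exists y, evolve s (@norm1 d) y <= K.
Proof.
move=> hs h0 hge.
have h0L : lipschitz_ball K (h 0%N).
  by move=> x n; rewrite !h0; exact: lipschitz_norm1.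
have hg i y : (i <= size s)%N -> norm1 y <= h i y + 0.
  by move=> si; rewrite addr0 hge.
have dual := pairing_duality hs h0L (@lipschitz_0 _ _) hg.
have dual' := @evolve_duality d K s (@norm1 d) (fun=> 0) (@lipschitz_norm1 _ _)
  (@lipschitz_0 _ _).
have e0 (u : site d -> int) : (exists y, u y <= K) <-> (exists y, u y + 0 <= K).
  by split=> -[y yK]; exists y; rewrite addr0 in yK *.
rewrite e0 dual e0 dual' => [|y]; last by rewrite addr0.
by split=> -[y yK]; exists y; rewrite h0 in yK *.
Qed.

(** * Surfaces driven by counting paths *)

Definition counting_path {R : realType} (c : R -> nat) : Prop :=
  (forall s t : R, 0 <= s -> s <= t -> (c s <= c t)%N) /\
  (forall t : R, 0 <= t -> \forall s \near t^'+, c s = c t).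

(** The last ring is the infimum of the times at which the counter has reached
    its final value; right continuity puts this infimum in the set. *)
Lemma last_ring (R : realType) (c : R -> nat) (s t : R) :
  counting_path c -> 0 <= s -> s <= t -> (c s < c t)%N ->
  exists u, [/\ s < u <= t, rings c u, c u = c t &
                forall v, s <= v < u -> (c v < c t)%N].
Proof.
move=> [cmono crc] s0 st cst.
pose A := [set v | s <= v <= t /\ c v = c t].
have At : A t by split=> //; rewrite st lexx.
have Alb : lbound A s by move=> v [/andP[]].
have Ainf : has_inf A by split; [exists t|exists s].
have su : s <= inf A by apply: lb_le_inf => //; exists t.
have ut : inf A <= t by apply: ge_inf => //; exists s.
have cu : c (inf A) = c t.
  have [e /= e0 he] := crc _ (le_trans s0 su).
  have [v [/andP[sv vt] cv] ve] := inf_adherent e0 Ainf.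
  have : inf A <= v by apply: ge_inf; [exists s|split=> //; rewrite sv].
  rewrite le_eqVlt => /orP[/eqP->//|uv]; rewrite -cv; apply/esym/he => //=.
  by rewrite distrC ger0_norm ?subr_ge0 ?(ltW uv)//; lra.
have hlt v : s <= v < inf A -> (c v < c t)%N.
  move=> /andP[sv vu]; rewrite ltn_neqAle cmono ?andbT//; try lra.
  apply/eqP => cvt; suff : inf A <= v by lra.
  by apply: ge_inf; [exists s|split=> //; lra].
have su' : s < inf A.
  rewrite lt_neqAle su andbT; apply/eqP => e.
  by move: cst; rewrite e cu ltnn.
exists (inf A); split=> //; first by rewrite su' ut.
split; first by lra.
move=> v v0 vu; rewrite cu; case: (lerP s v) => sv; first by apply: hlt; lra.
by apply: leq_ltn_trans cst; apply: cmono => //; lra.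
Qed.

Lemma near_left_ex (R : realType) (a u : R) (Q : R -> Prop) : a < u ->
  (\forall s \near u^'-, Q s) -> exists2 v, a < v < u & Q v.
Proof.
move=> au Qu; have : \forall s \near u^'-, a < s < u /\ Q s.
  near=> s; split; last by near: s.
  by apply/andP; split; near: s; [exact: nbhs_left_gt|exact: nbhs_left_lt].
by move=> /filter_ex[v [avu Qv]]; exists v.
Unshelve. all: by end_near. Qed.

Section rsos_path_theory.
Context {R : realType} {d : nat} (c : site d -> R -> nat).
Context (h0 : site d -> int) (h : R -> site d -> int).
Hypothesis cP : forall x, counting_path (c x).
Hypothesis hP : rsos_path (fun x => rings (c x)) h0 h.

Lemma rsos_constant s t x : 0 <= s -> s <= t -> c x s = c x t ->
  h t x = h s x.
Proof.
move=> s0 st cst; apply: (rsos_frozen hP) => // u su ut [u0 /(_ s s0 su)].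
by rewrite cst ltnNge (cP x).1//; lra.
Qed.

(** Strong induction on the value of the counter: before the last ring the
    height is the left limit there, and the ring does not lower it. *)
Lemma rsos_nondecreasing s t x : 0 <= s -> s <= t -> h s x <= h t x.
Proof.
move: {2}(c x t) (leqnn (c x t)) => m; elim: m t => [|m IH] t ctm s0 st;
  (case: (ltnP (c x s) (c x t)) => cst;
    last by rewrite (@rsos_constant s t)//; apply/eqP;
      rewrite eqn_leq cst (cP x).1).
  by move: cst; lia.
have [u [/andP[su ut] ru cu clt]] := last_ring (cP x) s0 st cst.
have u0 : 0 < u by lra.
rewrite (@rsos_constant u t x) ?(ltW u0)//.
have [hl [hlim ->]] := rsos_jump hP u0 ru.
have [v /andP[sv vu] <-] := near_left_ex su (hlim x).
rewrite prod_nat_of_bool; have : h s x <= h v x; last by lia.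
apply: IH => //; last exact: ltW.
by have := clt v; rewrite (ltW sv) vu => /(_ isT); lia.
Qed.

(** Up to its unique ring the site has kept its height, and the neighbours keep
    theirs throughout, so the left limits seen by the ring are the heights at the
    start of the interval. *)
Lemma rsos_one_ring a b x : 0 <= a -> a <= b -> c x b = (c x a).+1 ->
  (forall n, n \in neighbours d -> c (x + n) a = c (x + n) b) ->
  h b x = rsos_update (Some x) (h a) x.
Proof.
move=> a0 ab cx cn; rewrite /rsos_update eqxx.
have [|u [/andP[au ub] ru cu clt]] := last_ring (cP x) a0 ab.
  by rewrite cx.
have u0 : 0 < u by lra.
rewrite (@rsos_constant u b x) ?(ltW u0)//.
have [hl [hlim ->]] := rsos_jump hP u0 ru.
have hlE y : (forall v, a <= v < u -> c y a = c y v) -> hl y = h a y.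
  move=> cy; have [v /andP[av vu] <-] := near_left_ex au (hlim y).
  by apply: rsos_constant; rewrite ?(ltW av)//; apply: cy; rewrite (ltW av).
have hlx : hl x = h a x.
  apply: hlE => v /andP[av vu]; apply/eqP; rewrite eqn_leq (cP x).1//=.
  by have := clt v; rewrite av vu cx => /(_ isT).
congr (_ + _); first exact: hlx.
rewrite !big_seq; apply: eq_bigr => n nd; rewrite hlx hlE// => v /andP[av vu].
apply/eqP; rewrite eqn_leq (cP _).1//= (cn n nd) (cP _).1//; first lra.
by rewrite (le_trans (ltW vu)).
Qed.

End rsos_path_theory.

(** The box has radius [K + 2] since the update of a site of the ball of radius
    [K + 1] also reads the neighbours of that site. *)
Lemma rsos_path_follows (R : realType) (d : nat) (c : site d -> R -> nat)
    (h0 : site d -> int) (h : R -> site d -> int) (K : int)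
    (s : seq (option (site d))) (u : nat -> R) :
  (forall x, counting_path (c x)) ->
  rsos_path (fun x => rings (c x)) h0 h ->
  0 <= u 0%N -> nondecreasing_seq u ->
  (forall i x, (i < size s)%N -> norm1 x <= K + 2 ->
    c x (u i.+1) = (c x (u i) + (nth None s i == Some x))%N) ->
  follows K s (fun i => h (u i)).
Proof.
move=> cP hP u0 umono cE i si y yK.
have ui : 0 <= u i by rewrite (le_trans u0)// umono.
have uii : u i <= u i.+1 by exact: umono.
have [sy|sy] := eqVneq (nth None s i) (Some y).
  rewrite sy; apply: (rsos_one_ring cP hP) => //.
    by rewrite cE// ?sy ?eqxx ?addn1//; lia.
  move=> n nd; rewrite (cE i)//; last by have := norm1_neighbour y nd; lia.
  rewrite sy [X in nat_of_bool X](_ : _ = false) ?addn0//.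
  by apply/negbTE; rewrite (inj_eq Some_inj) eq_sym neighbours_neq.
rewrite /rsos_update (negPf sy); apply: (rsos_constant cP hP) => //.
by rewrite (cE i)// ?(negPf sy) ?addn0//; lia.
Qed.

(** * Probability of a prescribed pattern of rings *)

Definition grid {R : realType} (delta : R) (i : nat) : R := i%:R * delta.

Definition increment_event {R : realType} {T : Type} (X : R -> T -> nat)
    (delta : R) (i k : nat) : set T :=
  [set w | (X (grid delta i.+1) w - X (grid delta i) w)%N = k].

Lemma grid_ge0 (R : realType) (delta : R) i : 0 <= delta -> 0 <= grid delta i.
Proof. by move=> ?; rewrite mulr_ge0. Qed.

Lemma nondecreasing_grid (R : realType) (delta : R) :
  0 <= delta -> nondecreasing_seq (grid delta).
Proof. by move=> ? i j ij; rewrite /grid ler_wpM2r// ler_nat. Qed.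

(** This is what lets the independence of the clocks, stated for their generated
    sigma-algebras, apply to the pattern of the increments of one clock. *)
Lemma increment_sigma (R : realType) (T : pointedType) (X : R -> T -> nat)
    (delta : R) (s : {fset nat}) (k : nat -> nat) : 0 <= delta ->
  sigma_of_process X
    (\bigcap_(i in [set` s]) increment_event X delta i (k i)).
Proof.
move=> d0; pose G := \bigcup_(t in [set t : R | 0 <= t])
  preimage_set_system setT (X t) measurable.
have mX u i : 0 <= u -> G.-sigma.-measurable [set w | X u w = i].
  move=> u0; apply: sub_sigma_algebra; exists u => //; exists [set i] => //.
  by rewrite setTI.
suff : G.-sigma.-measurable
  (\bigcap_(i in [set` s]) increment_event X delta i (k i)) by [].
apply: fin_bigcap_measurable => [|i _]; first exact: finite_fset.
rewrite (_ : increment_event _ _ _ _ =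
    \bigcup_a \bigcup_(b in [set b | (b - a)%N = k i])
    ([set w | X (grid delta i) w = a] `&` [set w | X (grid delta i.+1) w = b])).
  apply: bigcupT_measurable => a; apply: bigcup_measurable => b _.
  by apply: measurableI; apply: mX; exact: grid_ge0.
apply/seteqP; split=> [w /= wk|w [a _ [b /= <-] [<- <-]]] //.
by exists (X (grid delta i) w) => //; exists (X (grid delta i.+1) w).
Qed.

(** The symbol of a slot names the only site of the box that rings in it, so
    the pattern lists, in order, the updates undergone by the box. *)
Definition slots_event {R : realType} {T : Type} {I : choiceType}
    (X : I -> R -> T -> nat) (L : {fset I}) (delta : R)
    (s : seq (option I)) : set T :=
  \bigcap_(x in [set` L]) \bigcap_(i in [set` [fset i in iota 0 (size s)]%fset])
    increment_event (X x) delta i (nth None s i == Some x).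

Lemma slots_eventP (R : realType) (T : Type) (I : choiceType)
    (X : I -> R -> T -> nat) (L : {fset I}) delta s w :
  slots_event X L delta s w <-> forall x i, x \in L -> (i < size s)%N ->
    (X x (grid delta i.+1) w - X x (grid delta i) w)%N =
      (nth None s i == Some x) :> nat.
Proof.
split=> [ws x i xL si|ws x xL i /=].
  by apply: (ws x xL i); rewrite /= !inE mem_iota.
by rewrite !inE mem_iota => si; exact: ws.
Qed.

Definition slot_weight {R : realType} {I : choiceType} (L : {fset I})
    (delta : R) (o : option I) : R :=
  \prod_(x <- L) poisson_pmf delta (o == Some x).

Section slots_law.
Context {R : realType} {d : nat} {dsp : measure_display}
  {T : measurableType dsp} {P : probability T R}
  {N : site d -> R -> {RV P >-> nat}} (NP : poisson_clocks N).
Context (L : {fset site d}) (delta : R) (delta_gt0 : 0 < delta).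

Local Notation count := (fun x t => N x t : T -> nat).

Lemma sigma_clock x : sigma_of_process (count x) `<=` measurable.
Proof.
apply: smallest_sub; first exact: sigma_algebra_measurable.
move=> A [t _ [B mB <-]]; exact: measurable_funP.
Qed.

Lemma measurable_slots_event s : measurable (slots_event count L delta s).
Proof.
apply: fin_bigcap_measurable => [|x _]; first exact: finite_fset.
by apply: sigma_clock; apply: increment_sigma; exact: ltW.
Qed.

(** Independence across the clocks, then across the increments of each clock;
    exchanging the two products groups the factors slot by slot. *)
Lemma probability_slots_event s :
  P (slots_event count L delta s) =
  (\prod_(o <- s) slot_weight L delta o)%:E.
Proof.
rewrite (poisson_clocks_indep NP) => [|x xL]; last first.
  by apply: increment_sigma; exact: ltW.
transitivity (\prod_(x <- L) (\prod_(i < size s)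
    poisson_pmf delta (nth None s i == Some x))%:E)%E; last first.
  by rewrite prodEFin exchange_big/= (big_nth None) big_mkord.
apply: eq_bigr => x _.
rewrite (poisson_process_indep (poisson_clocksP NP x) (u := grid delta)).
- rewrite -prodEFin -(big_mkord xpredT
    (fun i => (poisson_pmf delta (nth None s i == Some x))%:E)).
  rewrite (perm_big (iota 0 (size s))) /=; last first.
    apply: uniq_perm; rewrite ?fset_uniq ?iota_uniq// => i.
    by rewrite !inE.
  rewrite /index_iota subn0; apply: eq_bigr => i _.
  rewrite /increment_event (poisson_process_law (poisson_clocksP NP x)).
  + by congr (poisson_pmf _ _)%:E; rewrite /grid -mulrBl -natrB// subSnn mul1r.
  + by rewrite grid_ge0// ltW.
  + by rewrite /grid ltr_pM2r// ltr_nat.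
- by rewrite grid_ge0// ltW.
- by apply: nondecreasing_grid; exact: ltW.
- move=> i _; exists [set nat_of_bool (nth None s i == Some x)] => //.
  by rewrite setTI.
Qed.

End slots_law.

(** * Total weight of the patterns *)

Lemma sum_option (V : nmodType) (I : finType) (F : option I -> V) :
  \sum_o F o = F None + \sum_i F (Some i).
Proof.
rewrite (bigD1 None)//=; congr (_ + _); rewrite (reindex_omap Some id).
  by apply: eq_bigl => i; rewrite eqxx.
by case.
Qed.

Lemma sum_tuple_prod (R : comNzRingType) (I : finType) (n : nat) (F : I -> R) :
  \sum_(s : n.-tuple I) \prod_(i <- s) F i = (\sum_i F i) ^+ n.
Proof.
rewrite -[in RHS](card_ord n) -prodr_const bigA_distr_bigA/=.
rewrite (reindex (fun f : {ffun 'I_n -> I} => [tuple f i | i < n])).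
  by apply: eq_bigr => f _; rewrite big_map big_enum.
exists (fun s : n.-tuple I => [ffun i => tnth s i]) => [f _|s _].
  by apply/ffunP => i; rewrite ffunE tnth_mktuple.
by apply: eq_from_tnth => i; rewrite tnth_mktuple ffunE.
Qed.

Lemma bernoulli_power (R : realDomainType) (a : R) n :
  0 <= a -> 1 - n%:R * (1 - a) <= a ^+ n.
Proof.
move=> a0; elim: n => [|n IH]; first by rewrite expr0; lra.
rewrite exprS; have := ler_wpM2l a0 IH; apply: le_trans.
rewrite -subr_ge0 -natr1.
rewrite (_ : _ - _ = n%:R * ((1 - a) * (1 - a))); last by ring.
by rewrite mulr_ge0// -expr2 sqr_ge0.
Qed.

Section slots.
Context {R : realType} {I : choiceType} (L : {fset I}).
Implicit Type delta : R.

Definition slots (n : nat) (s : n.-tuple (option L)) : seq (option I) :=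
  map (omap val) s.

Definition slots_weight delta (n : nat) (s : n.-tuple (option L)) : R :=
  \prod_(o <- slots s) slot_weight L delta o.

Lemma slot_weightE delta (o : option L) : 0 < delta ->
  slot_weight L delta (omap val o) =
  delta ^+ (o != None) * expR (- delta) ^+ #|` L|.
Proof.
move=> d0; rewrite /slot_weight.
transitivity
  (\prod_(x <- L) (delta ^+ (omap val o == Some x) * expR (- delta))).
  apply: eq_bigr => x _; rewrite /poisson_pmf d0; congr (_ * _).
  by case: (_ == _); rewrite ?fact0 invr1 mulr1.
rewrite big_split/= big_const_seq count_predT iter_mulr_1 prodrXr.
congr (_ ^+ _ * _).
case: o => [y|] /=; last by rewrite big1.
transitivity (count_mem (val y) L).
  rewrite -sum1_count [RHS]big_mkcond/=; apply: eq_bigr => x _.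
  by rewrite (inj_eq Some_inj) eq_sym; case: eqP.
by rewrite count_uniq_mem ?fset_uniq// fsvalP.
Qed.

Lemma slots_weight_rev delta n (s : n.-tuple (option L)) :
  slots_weight delta [tuple of rev s] = slots_weight delta s.
Proof.
by rewrite /slots_weight /slots map_rev; apply: perm_big; rewrite perm_rev.
Qed.

(** With [m] sites in the box, the weights of one slot add up to
    [exp (- m delta) (1 + m delta)], which is at least [1 - (m delta) ^ 2]; the
    sum over all patterns is the [n]-th power of this. *)
Lemma total_slots_weight delta n : 0 < delta ->
  1 - n%:R * (#|` L|%:R * delta) ^+ 2 <=
  \sum_(s : n.-tuple (option L)) slots_weight delta s.
Proof.
move=> d0; rewrite /slots_weight.
under eq_bigr do rewrite big_map.
rewrite sum_tuple_prod sum_option; set m := #|` L|.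
rewrite (slot_weightE None d0) mul1r.
under eq_bigr do rewrite (slot_weightE (Some _) d0) expr1.
rewrite sumr_const -cardfE -/m; set e := expR _ ^+ m.
rewrite (_ : e + _ = e * (1 + m%:R * delta)); last by rewrite -mulr_natl; ring.
have m0 : 0 <= m%:R * delta :> R by rewrite mulr_ge0// ltW.
have e0 : 0 <= e by rewrite exprn_ge0// expR_ge0.
have eE : 1 - m%:R * delta <= e.
  by rewrite /e -expRM_natl mulrN; exact: expR_ge1Dx.
apply: le_trans (bernoulli_power _ _); last by rewrite mulr_ge0//; lra.
rewrite lerD2l lerN2 ler_wpM2l//.
have : (1 - m%:R * delta) * (1 + m%:R * delta) <= e * (1 + m%:R * delta).
  by rewrite ler_wpM2r//; lra.
by lra.
Qed.

Lemma slots_nth_neq n (s s' : n.-tuple (option L)) : s != s' ->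
  exists i x, [/\ (i < n)%N, x \in L &
    (nth None (slots s) i == Some x) != (nth None (slots s') i == Some x)].
Proof.
move=> ss'.
have [i si] : exists i, tnth s i != tnth s' i.
  apply/existsP; rewrite -[X in is_true X]negbK negb_exists.
  apply: contra ss' => /forallP si; apply/eqP/eq_from_tnth => i.
  by have := si i; rewrite negbK => /eqP.
have nE (u : n.-tuple (option L)) : nth None (slots u) i = omap val (tnth u i).
  by rewrite (nth_map None) ?size_tuple// -tnth_nth.
exists i; move: si; rewrite !nE; case: (tnth s i) => [x|].
  move=> sx; exists (val x); split; rewrite ?fsvalP//= eqxx.
  case: (tnth s' i) sx => [y|]//=; rewrite !(inj_eq Some_inj) => xy.
  by rewrite (inj_eq val_inj) [y == x]eq_sym (negPf xy).
case: (tnth s' i) => [y _|]//=; exists (val y); split; rewrite ?fsvalP//.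
by rewrite eqxx.
Qed.

End slots.

(** * Estimating a probability from the patterns *)

Lemma sum_measure_disjoint_le (R : realType) (dsp : measure_display)
    (T : measurableType dsp) (P : {measure set T -> \bar R}) (I : eqType)
    (s : seq I) (E : I -> set T) (X : set T) :
  uniq s -> (forall i, measurable (E i)) ->
  (forall i j, i != j -> E i `&` E j = set0) -> measurable X ->
  (forall i, i \in s -> E i `<=` X) ->
  (\sum_(i <- s) P (E i) <= P X)%E.
Proof.
move=> us mE tE; elim: s us X => [_ X _ _|i s IH /andP[iNs us] X mX EX].
  by rewrite big_nil.
rewrite big_cons (measureDI P mX (mE i)) addeC setIidr; last first.
  by apply: EX; rewrite mem_head.
rewrite leeD2r// IH//; first exact: measurableD.
move=> j js w Ew; split; first by apply: (EX j) => //; rewrite inE js orbT.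
move=> Eiw; have ij : i != j by apply: contraNneq iNs => ->.
by have : (E i `&` E j) w by []; rewrite tE.
Qed.

Section slots_bound.
Context {R : realType} {d : nat} {dsp : measure_display}
  {T : measurableType dsp} {P : probability T R}
  {N : site d -> R -> {RV P >-> nat}} (NP : poisson_clocks N).
Context (L : {fset site d}) (delta : R) (delta_gt0 : 0 < delta) (n : nat).

Local Notation count := (fun x t => N x t : T -> nat).

Lemma slots_lower_bound (psi : pred (n.-tuple (option L))) (X : set T) :
  measurable X ->
  {ae P, forall w (s : n.-tuple (option L)),
    psi s -> slots_event count L delta (slots s) w -> X w} ->
  ((\sum_(s | psi s) slots_weight delta s)%:E <= P X)%E.
Proof.
move=> mX [Z [mZ PZ0 XZ]].
pose E s := slots_event count L delta (@slots _ L n s).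
have mE s : measurable (E s) by exact: (measurable_slots_event _ delta_gt0).
have PE s : P (E s `\` Z) = (slots_weight delta s)%:E.
  rewrite /slots_weight -(probability_slots_event NP L delta_gt0).
  rewrite -/(E s) (measureDI P (mE s) mZ).
  rewrite [X in (_ + X)%E](_ : _ = 0%E) ?adde0//.
  by apply: (subset_measure0 _ _ _ PZ0) => //; exact: measurableI.
rewrite -sumEFin -big_filter; under eq_bigr do rewrite -PE.
apply: sum_measure_disjoint_le => //.
- by rewrite filter_uniq// index_enum_uniq.
- by move=> s; exact: measurableD.
- move=> s s' /slots_nth_neq[i [x [ni xL xi]]]; apply/seteqP; split=> // w.
  move=> [[/slots_eventP Ew _] [/slots_eventP Ew' _]].
  move: xi; have := Ew x i xL; have := Ew' x i xL.
  rewrite !size_map !size_tuple => /(_ ni) -> /(_ ni).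
  by case: (_ == _); case: (_ == _).
move=> s; rewrite mem_filter => /andP[ps _] w [Ew nZ].
apply: contrapT => nX; apply: nZ; apply: XZ => /= XP; exact: nX (XP _ ps Ew).
Qed.

(** The lower bound for [X] and the one for its complement enclose the
    probability of [X]. *)
Lemma slots_two_sided (psi : pred (n.-tuple (option L))) (X : set T) :
  measurable X ->
  {ae P, forall w (s : n.-tuple (option L)),
    slots_event count L delta (slots s) w -> (X w <-> psi s)} ->
  `|fine (P X) - \sum_(s | psi s) slots_weight delta s| <=
    1 - \sum_(s : n.-tuple (option L)) slots_weight delta s.
Proof.
move=> mX ae; pose q (s : n.-tuple (option L)) := slots_weight delta s.
have PX : P X = (fine (P X))%:E by rewrite fineK// fin_num_measure.
have low : \sum_(s | psi s) q s <= fine (P X).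
  rewrite -lee_fin -PX; apply: slots_lower_bound => //.
  by apply: filterS ae => w Xw s ps Ew; apply/(Xw s Ew).
have up : \sum_(s | ~~ psi s) q s <= 1 - fine (P X).
  rewrite -lee_fin EFinB -PX -probability_setC//.
  apply: slots_lower_bound; first exact: measurableC.
  by apply: filterS ae => w Xw s /negP ps Ew /(Xw s Ew).
rewrite ger0_norm ?subr_ge0// [X in _ <= 1 - X](bigID psi)/=.
by rewrite -!/(q _); lra.
Qed.

End slots_bound.

(** * The RSOS process seen through the patterns *)

Lemma ball_finite (d : nat) (K : int) :
  exists L : {fset site d}, forall x, norm1 x <= K -> x \in L.
Proof.
pose k := `|K|%N.
pose shift (f : {ffun 'I_d -> 'I_(k.*2.+1)}) : site d :=
  \row_i ((f i : nat)%:Z - k%:Z).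
exists [fset x in [seq shift f | f <- enum {ffun 'I_d -> 'I_(k.*2.+1)}]]%fset
  => x xK.
rewrite !inE; apply/mapP.
have xi i : `|x ord0 i| <= K.
  apply: le_trans xK; rewrite /norm1 (bigD1 i)//= lerDl; exact: sumr_ge0.
exists [ffun i => inord `|(x ord0 i + k%:Z)%R|%N]; first by rewrite mem_enum.
by apply/rowP => i; rewrite mxE ffunE inordK; have := xi i;
  rewrite /k (ord1 ord0); move: (x 0 i) => a; lia.
Qed.

Lemma min_value_le_iff (I : Type) (g : I -> int) (K : int) :
  (exists y, minimizer g y) -> (min_value g <= K) <-> exists y, g y <= K.
Proof.
move=> [y gy]; rewrite (min_value_eq gy).
split=> [gK|[z zK]]; first by exists y.
by rewrite (le_trans (gy z)).
Qed.

(** The values of [g] are nonnegative integers, so they have a least element. *)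
Lemma minimizer_exists (d : nat) (g : site d -> int) :
  (forall y, norm1 y <= g y) -> exists y, minimizer g y.
Proof.
move=> gn.
have [m [[y ym] mmin]] : exists m : nat, (exists y, g y <= m%:Z) /\
    forall k : nat, (exists y, g y <= k%:Z) -> (m <= k)%N.
  have ex : exists m : nat, `[< exists y, g y <= m%:Z >].
    exists `|g 0%R|%N; apply/asboolP; exists 0; lia.
  exists (ex_minn ex); case: ex_minnP => m /asboolP mP mmin; split=> // k kP.
  by apply: mmin; apply/asboolP.
exists y => z; have z0 := norm1_ge0 z; have gz := gn z.
have mz : (m <= `|g z|)%N by apply: mmin; exists z; lia.
lia.
Qed.

Lemma ae_countable (R : realType) (dsp : measure_display)
    (T : measurableType dsp) (P : {measure set T -> \bar R}) (I : countType)
    (Q : I -> T -> Prop) :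
  (forall i, {ae P, forall w, Q i w}) -> {ae P, forall w i, Q i w}.
Proof.
move=> PQ.
have : {ae P, forall w (n : nat),
    if @choice.unpickle I n is Some i then Q i w else True}.
  apply: ae_foralln => n; case: (choice.unpickle n) => [i|]; first exact: PQ.
  exact: aeW.
apply: filterS => w Qw i; have := Qw (choice.pickle i).
by rewrite choice.pickleK.
Qed.

Section rsos_process_theory.
Context {R : realType} {d : nat} {dsp : measure_display}
  {T : measurableType dsp} {P : probability T R}
  {N : site d -> R -> {RV P >-> nat}} {h0 : site d -> int}
  {h : R -> site d -> {RV P >-> int}} (hP : rsos_process N h0 h).

Definition regular_path (w : T) : Prop :=
  (forall x, counting_path (fun t => N x t w)) /\
  rsos_path (fun x => rings (fun t => N x t w)) h0 (fun t x => h t x w).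

Lemma ae_regular_path : {ae P, forall w, regular_path w}.
Proof.
have [NP hpath] := hP; apply: (filterI _ hpath).
apply: ae_countable => x; exact: (poisson_process_path (poisson_clocksP NP x)).
Qed.

Lemma regular_path_nondecreasing w : regular_path w ->
  forall t x, 0 <= t -> h0 x <= h t x w.
Proof.
move=> [Nw hw] t x t0; rewrite -(rsos_init hw x).
exact: (rsos_nondecreasing Nw hw).
Qed.

Lemma regular_path_follows (K : int) (L : {fset site d}) (delta : R)
    (n : nat) (s : n.-tuple (option L)) w :
  (forall x, norm1 x <= K + 2 -> x \in L) -> 0 < delta -> regular_path w ->
  slots_event (fun x t => N x t : T -> nat) L delta (slots s) w ->
  follows K (slots s) (fun i x => h (grid delta i) x w).
Proof.
move=> LK d0 [Nw hw] /slots_eventP sw.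
apply: (rsos_path_follows (u := grid delta) Nw hw) => [||i x si xK].
- exact/grid_ge0/ltW.
- exact/nondecreasing_grid/ltW.
rewrite -(sw x i (LK _ xK) si) subnKC//; apply: (Nw x).1.
  exact/grid_ge0/ltW.
by apply: nondecreasing_grid; rewrite ?ltW.
Qed.

End rsos_process_theory.

(** Both height events are expressed by this one condition on the pattern, the
    flat surface reading the pattern backwards. *)
Definition wedge_below {d : nat} {L : {fset site d}} (K : int) (n : nat)
    (s : n.-tuple (option L)) : bool :=
  `[< exists y, evolve (slots s) (@norm1 d) y <= K >].

Lemma rsos_origin_slots (R : realType) (d : nat) (dsp : measure_display)
    (T : measurableType dsp) (P : probability T R)
    (N : site d -> R -> {RV P >-> nat}) (f : R -> site d -> {RV P >-> int})
    (K : int) (L : {fset site d}) (delta : R) (n : nat) :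
  rsos_process N (fun=> 0) f ->
  (forall x, norm1 x <= K + 2 -> x \in L) -> 0 < delta ->
  {ae P, forall w (s : n.-tuple (option L)),
    slots_event (fun x t => N x t : T -> nat) L delta (slots s) w ->
    (f (grid delta n) 0 w <= K) <-> wedge_below K [tuple of rev s]}.
Proof.
move=> fP LK d0; apply: filterS (ae_regular_path fP) => w rw s sw.
have fw := regular_path_follows LK d0 rw sw.
have ss : size (slots s) = n by rewrite size_map size_tuple.
have := flat_origin fw; rewrite ss => ->.
- split=> [yK|/asboolP].
    by apply/asboolP; rewrite /slots map_rev.
  by rewrite /slots map_rev.
- by move=> y; rewrite /grid mul0r (rsos_init rw.2).
- by move=> i y _; apply: (regular_path_nondecreasing rw); exact/grid_ge0/ltW.
Qed.

Lemma dual_rsos_minimizer (R : realType) (d : nat) (dsp : measure_display)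
    (T : measurableType dsp) (P : probability T R)
    (N : site d -> R -> {RV P >-> nat}) (f : R -> site d -> {RV P >-> int})
    (t : R) :
  rsos_process N (@norm1 d) f -> 0 <= t ->
  {ae P, forall w, exists y, minimizer (fun z => f t z w) y}.
Proof.
move=> fP t0; apply: filterS (ae_regular_path fP) => w rw.
by apply: minimizer_exists => y; exact: (regular_path_nondecreasing rw).
Qed.

Lemma dual_rsos_min_slots (R : realType) (d : nat) (dsp : measure_display)
    (T : measurableType dsp) (P : probability T R)
    (N : site d -> R -> {RV P >-> nat}) (f : R -> site d -> {RV P >-> int})
    (K : int) (L : {fset site d}) (delta : R) (n : nat) :
  rsos_process N (@norm1 d) f ->
  (forall x, norm1 x <= K + 2 -> x \in L) -> 0 < delta ->
  {ae P, forall w (s : n.-tuple (option L)),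
    slots_event (fun x t => N x t : T -> nat) L delta (slots s) w ->
    (min_height (f (grid delta n)) w <= K) <-> wedge_below K s}.
Proof.
move=> fP LK d0; have gn0 := grid_ge0 n (ltW d0).
apply: filterS2 (dual_rsos_minimizer fP gn0) (ae_regular_path fP).
move=> w mw rw s sw; have fw := regular_path_follows LK d0 rw sw.
rewrite /min_height (min_value_le_iff _ mw).
have ss : size (slots s) = n by rewrite size_map size_tuple.
have := wedge_min fw; rewrite ss => ->.
- by split=> [yK|/asboolP//]; exact/asboolP.
- by move=> y; rewrite /grid mul0r (rsos_init rw.2).
- by move=> i y _; apply: (regular_path_nondecreasing rw); exact/grid_ge0/ltW.
Qed.

(** * Equality of the distributions *)

Lemma eq_from_inverse_bound (R : realType) (x y C : R) :
  (forall n : nat, `|x - y| <= C / n.+1%:R) -> x = y.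
Proof.
move=> xyC; apply/eqP; rewrite -subr_eq0 -normr_le0; apply/ler_addgt0Pr => e e0.
rewrite add0r.
have C0 : 0 <= C by have := xyC 0%N; rewrite divr1; exact: le_trans.
have := xyC `|Num.floor (C / e)|%N; move=> /le_trans; apply.
rewrite ler_pdivrMr// mulrC -ler_pdivrMr// -natr1.
have Ce : 0 <= C / e by rewrite divr_ge0// ltW.
rewrite (_ : _%:R = (Num.floor (C / e))%:~R) ?ltW ?floorD1_gt//; last first.
  by rewrite -[in RHS](gez0_abs (_ : 0 <= Num.floor (C / e)))// floor_ge0.
by rewrite -[1]/(1%:~R) -intrD floorD1_gt.
Qed.

Lemma measurable_ray (dsp : measure_display) (T : measurableType dsp)
    (X : {mfun T >-> int}) (K : int) : measurable [set w | X w <= K].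
Proof.
by rewrite -[X in measurable X]setTI;
  apply: (measurable_funPT X _ [set k | k <= K]).
Qed.

Section rsos_duality.
Context {R : realType} {d : nat} {dsp dspD : measure_display}
  {T : measurableType dsp} {TD : measurableType dspD}
  {P : probability T R} {PD : probability TD R}
  {N : site d -> R -> {RV P >-> nat}} {f : R -> site d -> {RV P >-> int}}
  {ND : site d -> R -> {RV PD >-> nat}} {fD : R -> site d -> {RV PD >-> int}}.
Hypotheses (fP : rsos_process N (fun=> 0) f)
  (fDP : rsos_process ND (@norm1 d) fD).

(** Both probabilities are close to the weight of the same set of patterns,
    after the reversal of the patterns in the sum for the flat surface. *)
Lemma rsos_duality_error (K : int) (L : {fset site d}) (delta : R) (n : nat) :
  (forall x, norm1 x <= K + 2 -> x \in L) -> 0 < delta ->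
  `|fine (P [set w | f (grid delta n) 0 w <= K]) -
    fine (PD [set w | min_height (fD (grid delta n)) w <= K])| <=
  2 * (n%:R * (#|` L|%:R * delta) ^+ 2).
Proof.
move=> LK d0; set p := fine _; set p' := fine _.
pose q := \sum_(s : n.-tuple (option L) | wedge_below K s) slots_weight delta s.
have revE : \sum_(s : n.-tuple (option L) | wedge_below K [tuple of rev s])
    slots_weight delta s = q.
  rewrite [RHS](reindex_inj (h := fun s : n.-tuple (option L) =>
    [tuple of rev s])).
    by apply: eq_bigr => s _; rewrite slots_weight_rev.
  by move=> s s' /(congr1 val)/(inv_inj (@revK _))/val_inj.
have pE := slots_two_sided fP.1 d0 (measurable_ray _ K)
  (rsos_origin_slots n fP LK d0).
rewrite revE -/p in pE.
have p'E : `|p' - q| <= 1 - \sum_(s : n.-tuple (option L)) slots_weight delta s.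
  exact: (slots_two_sided fDP.1 d0 (measurable_ray _ K)
    (dual_rsos_min_slots n fDP LK d0)).
have tot := total_slots_weight L n d0.
have := ler_distD q p p'; rewrite (distrC q).
by lra.
Qed.

Lemma rsos_duality_rays (t : R) (K : int) : 0 <= t ->
  P [set w | f t 0 w <= K] = PD [set w | min_height (fD t) w <= K].
Proof.
move=> t_ge0; have [L LK] := ball_finite d (K + 2).
rewrite -[LHS]fineK ?fin_num_measure//; last exact: measurable_ray.
rewrite -[RHS]fineK ?fin_num_measure//; last exact: measurable_ray.
congr EFin; move: t_ge0; rewrite le_eqVlt => /predU1P[<-|t_gt0].
  (* At time 0 there are no slots, and the error bound is already zero. *)
  have := rsos_duality_error 0 LK ltr01; rewrite /grid !mul0r mulr0.
  by rewrite normr_le0 subr_eq0 => /eqP.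
apply: (@eq_from_inverse_bound _ _ _ (2 * (#|` L|%:R * t) ^+ 2)) => n.
have d0 : 0 < t / n.+1%:R by rewrite divr_gt0.
have := rsos_duality_error n.+1 LK d0.
have -> : grid (t / n.+1%:R) n.+1 = t by rewrite /grid mulrC divfK.
move=> /le_trans; apply; rewrite le_eqVlt; apply/orP; left; apply/eqP.
by field; rewrite ?natr1 ?nat1r pnatr_eq0.
Qed.

End rsos_duality.

Lemma eq_distribution_rays (R : realType) (dsp dsp' : measure_display)
    (T : measurableType dsp) (T' : measurableType dsp')
    (P : probability T R) (P' : probability T' R)
    (X : {RV P >-> int}) (X' : {RV P' >-> int}) :
  (forall K : int, P [set w | X w <= K] = P' [set w | X' w <= K]) ->
  forall A, distribution P X A = distribution P' X' A.
Proof.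
move=> XX' A.
have atomE dsp0 (T0 : measurableType dsp0) (P0 : probability T0 R)
    (Y : {RV P0 >-> int}) (k : int) :
    (P0 (Y @^-1` [set k]) =
     P0 [set w | (Y w <= k)%R] - P0 [set w | (Y w <= k - 1)%R])%E.
  rewrite (_ : Y @^-1` [set k] =
    [set w | Y w <= k] `\` [set w | Y w <= k - 1]); last first.
    by apply/seteqP; split => w /=; lia.
  rewrite measureD ?ltey_eq ?fin_num_measure//; try exact: measurable_ray.
  by rewrite setIidr// => w /=; lia.
(* The preimage of [A] is cut along the enumeration of the integers; each piece
   is the preimage of a singleton or is empty, whatever the function. *)
pose F U (Y : U -> int) n := [set w | A (Y w) /\ choice.pickle (Y w) = n].
have FE n :
    (exists k, forall U (Y : U -> int), F U Y n = Y @^-1` [set k]) \/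
    (forall U (Y : U -> int), F U Y n = set0).
  have [[k [Ak kn]]|nk] := pselect (exists k : int, A k /\ choice.pickle k = n).
    left; exists k => V Z.
    apply/seteqP; split=> w; rewrite /F /=; last by move=> ->.
    by move=> [_]; rewrite -kn => /(pcan_inj choice.pickleK).
  right=> V Z; apply/seteqP; split=> w //= [AZ Zn].
  by apply: nk; exists (Z w).
have sumE dsp0 (T0 : measurableType dsp0) (P0 : probability T0 R)
    (Y : {RV P0 >-> int}) :
    distribution P0 Y A = (\sum_(n <oo) P0 (F _ Y n))%E.
  have FA : \bigcup_n F _ Y n = Y @^-1` A.
    apply/seteqP; split=> w; first by move=> [n _ []].
    by move=> Aw; exists (choice.pickle (Y w)).
  rewrite /distribution /pushforward -FA measure_semi_bigcup//.
  - move=> n; have [[k ->]|->//] := FE n.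
    by rewrite -[X in measurable X]setTI; exact: measurable_funPT.
  - apply/trivIsetP => m n _ _ /eqP mn; apply/seteqP; split=> w //.
    by rewrite /F => -[[_ Ym] [_ Yn]]; apply: mn; rewrite -Ym.
  - by rewrite FA -[X in measurable X]setTI; exact: measurable_funPT.
rewrite !sumE; apply: eq_eseriesr => n _.
have [[k Fk]|F0] := FE n; last by rewrite !F0 !measure0.
by rewrite !Fk !atomE !XX'.
Qed.

Unset Implicit Arguments.

Theorem proposition6p2 (R : realType) (d : nat) (d_ge1 : (1 <= d)%N)
    (dsp dspD : measure_display)
    (Omega : measurableType dsp) (OmegaD : measurableType dspD)
    (P : probability Omega R) (PD : probability OmegaD R)
    (N : site d -> R -> {RV P >-> nat}) (f : R -> site d -> {RV P >-> int})
    (ND : site d -> R -> {RV PD >-> nat}) (fD : R -> site d -> {RV PD >-> int})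
    (f_rsos : rsos_process N (fun _ => 0) f)
    (fD_rsos : rsos_process ND (@norm1 d) fD)
    (t : R) (t_ge0 : 0 <= t) :
  {ae PD, forall w, exists y : site d, minimizer (fun z => fD t z w) y} /\
  forall A : set int,
    distribution P (f t 0) A = distribution PD (min_height (fD t)) A.
Proof.
split; first exact: (dual_rsos_minimizer fD_rsos).
by apply: eq_distribution_rays => K; exact: (rsos_duality_rays f_rsos fD_rsos).
Qed.
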